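(* Let $T>0$, $\alpha>1$, $\lambda,\mu>0$, and let $f_T,\eta,t_0$ be as in the context, with $t_0>0$. Define $$g(t):=f_T(t)^{-\frac1\alpha}\left(1-\exp\left(-\left(\frac{\mu}{\alpha-1}+\lambda\right)\eta(t)\right)\right),$$ and let $\tau^*\in\operatorname{argmax}_{\tau\in[0,t_0]}g(\tau)$. If $$1<\alpha\le1+\frac{\mu+\sqrt{4\lambda\mu+\mu^2}}{2\lambda},$$ then $f_T(t_0)^{-\frac1\alpha}\ge g(\tau^* )$.
   Context: For $t\in[0,T)$, $$\eta(t):=\int_0^t\frac{ds}{\bigl(1+\lambda(T-s)\bigr)^{\frac{\mu}{\lambda(\alpha-1)}+1}-1},$$ $$f_T(t):=\left(\frac{\mu+\lambda(\alpha-1)}{(\alpha-1)\left[\bigl(1+\lambda(T-t)\bigr)^{\frac{\mu}{\lambda(\alpha-1)}+1}-1\right]}\right)^{\alpha-1}\bigl(1+\lambda(T-t)\bigr)^{\frac{\mu}{\lambda}}\exp\left(-\alpha\left(\frac{\mu}{\alpha-1}+\lambda\right)\eta(t)\right).$$ $x_0$ denotes the unique real solution with $x>1$ of $$(\alpha-1)x^{\frac{\mu}{\lambda}+\alpha-1}-\alpha\left(\frac{\mu}{\lambda(\alpha-1)}+1\right)x^{\alpha-1}+\frac{\mu}{\lambda}=0,$$ and $t_0:=T-\frac{x_0^{\alpha-1}-1}{\lambda}$. *)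

(* Defs.v *)
(* Stdlib real numbers with Coquelicot's Riemann integral.  [Rpower x y] is the
   real power only for x > 0; every base below is positive on the domain of
   interest: 0 <= t < T, alpha > 1, lambda, mu > 0, x > 1. *)
From Stdlib Require Import Reals.
From Coquelicot Require Import Coquelicot.

Open Scope R_scope.

Definition eta (T alpha lambda mu t : R) : R :=
  RInt (fun s =>
    1 / (Rpower (1 + lambda * (T - s)) (mu / (lambda * (alpha - 1)) + 1) - 1))
    0 t.

Definition f_T (T alpha lambda mu t : R) : R :=
  Rpower
    ((mu + lambda * (alpha - 1)) /
     ((alpha - 1) *
      (Rpower (1 + lambda * (T - t)) (mu / (lambda * (alpha - 1)) + 1) - 1)))
    (alpha - 1)
  * Rpower (1 + lambda * (T - t)) (mu / lambda)
  * exp (- alpha * (mu / (alpha - 1) + lambda) * eta T alpha lambda mu t).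

Definition g (T alpha lambda mu t : R) : R :=
  Rpower (f_T T alpha lambda mu t) (- (1 / alpha))
  * (1 - exp (- (mu / (alpha - 1) + lambda) * eta T alpha lambda mu t)).

(* For alpha > 1 and lambda, mu > 0 exactly one x satisfies this predicate: with
   u = x ^ (alpha - 1) the left-hand side of the equation is strictly convex in
   u, negative at u = 1, and tends to +oo. *)
Definition is_x0 (alpha lambda mu x : R) : Prop :=
  1 < x /\
  (alpha - 1) * Rpower x (mu / lambda + alpha - 1)
  - alpha * (mu / (lambda * (alpha - 1)) + 1) * Rpower x (alpha - 1)
  + mu / lambda = 0.

Definition t0 (T alpha lambda x0 : R) : R :=
  T - (Rpower x0 (alpha - 1) - 1) / lambda.

Definition is_argmax (h : R -> R) (a b tau : R) : Prop :=
  a <= tau <= b /\ forall s, a <= s <= b -> h s <= h tau.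

(* Main.v *)
Require Import Defs.
From Stdlib Require Import Reals Lra Psatz.
From Coquelicot Require Import Coquelicot.

Open Scope R_scope.

(* Write u = 1 + lambda (T - t), a = (alpha - 1) / alpha,
   b = mu / (lambda (alpha - 1)), X = u^(b+1), E = lambda (b + 1) eta and
   F = f_T^(-1/alpha), so that g = F (1 - exp (- E)).  At an interior maximum,
   g' = 0 gives 1 - exp (- E) = (b + 1) u / (a (X + b)), hence g agrees there
   with F (b + 1) u / (a (X + b)).  The defining equation of x0 says that this
   expression equals F at t0, and it is nondecreasing in t because
   a (X + b)^2 <= b (X - 1)^2 + (b + 1) u (X + b) whenever a <= b, which is what
   the upper bound on alpha amounts to.  The endpoints are immediate: g(0) = 0
   and g <= F. *)

(** * Elementary inequalities for logarithms and powers *)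

Lemma is_derive_nonneg_le (f df : R -> R) (a b : R) :
  a <= b ->
  (forall x, a <= x <= b -> is_derive f x (df x)) ->
  (forall x, a <= x <= b -> 0 <= df x) ->
  f a <= f b.
Proof.
  intros hab hd hpos.
  destruct (MVT_gen f a b df) as (c & hc & heq).
  - intros x hx. rewrite Rmin_left, Rmax_right in hx by lra. apply hd; lra.
  - intros x hx. rewrite Rmin_left, Rmax_right in hx by lra.
    apply continuity_pt_filterlim, (ex_derive_continuous f).
    exists (df x). apply hd; lra.
  - rewrite Rmin_left, Rmax_right in hc by lra.
    assert (0 <= df c * (b - a)) by (apply Rmult_le_pos; [apply hpos | ]; lra).
    lra.
Qed.

Lemma ln_le_sub_1 (x : R) : 0 < x -> ln x <= x - 1.
Proof.
  intros hx. pose proof (exp_ineq1_le (ln x)) as h.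
  rewrite exp_ln in h by exact hx. lra.
Qed.

(** The left side is the Padé approximant of [ln] of type [1/1] at 1. The difference vanishes at 1
    and its derivative is a square over a positive quantity. *)
Lemma ln_ge_pade (x : R) : 1 <= x -> 2 * (x - 1) / (x + 1) <= ln x.
Proof.
  intros hx.
  assert (h : ln 1 - 2 * (1 - 1) / (1 + 1) <= ln x - 2 * (x - 1) / (x + 1)).
  { apply (is_derive_nonneg_le (fun y => ln y - 2 * (y - 1) / (y + 1))
             (fun y => (y - 1) ^ 2 / (y * (y + 1) ^ 2))).
    - exact hx.
    - intros y hy. auto_derive; [lra | field; lra].
    - intros y hy. apply Rdiv_le_0_compat; [apply pow2_ge_0 | ].
      apply Rmult_lt_0_compat; [lra | apply pow_lt; lra]. }
  rewrite ln_1 in h. lra.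
Qed.

Lemma Rpower_bernoulli_le (u b : R) :
  1 <= u -> 0 <= b <= 1 -> Rpower u b <= 1 + b * (u - 1).
Proof.
  intros hu hb.
  set (m := 1 + b * (u - 1)).
  assert (hm : 0 < m) by (unfold m; nra).
  (* Weighted AM-GM for [1/m] and [u/m], whose weighted mean is 1. *)
  pose proof (ln_le_sub_1 (1 / m) ltac:(apply Rdiv_lt_0_compat; lra)) as h1.
  pose proof (ln_le_sub_1 (u / m) ltac:(apply Rdiv_lt_0_compat; lra)) as h2.
  rewrite ln_div in h1, h2 by lra. rewrite ln_1 in h1.
  assert (hs : (1 - b) * (1 / m - 1) + b * (u / m - 1) = 0).
  { replace u with (1 + (u - 1)) by ring.
    replace ((1 - b) * (1 / m - 1) + b * ((1 + (u - 1)) / m - 1))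
      with ((1 + b * (u - 1)) / m - 1) by (field; lra).
    fold m. field. lra. }
  assert (b * ln u <= ln m) by nra.
  unfold Rpower. rewrite <- (exp_ln m hm). apply Rnot_lt_le.
  intros h%exp_lt_inv. lra.
Qed.

(* The difference of the two sides decreases in [a], so it suffices to take
   [a = b] when [b <= 1] and [a = 1] when [b > 1]. *)
Lemma key_inequality (a b u : R) :
  0 < a < 1 -> a <= b -> 1 <= u ->
  a * (Rpower u (b + 1) + b) ^ 2
    <= b * (Rpower u (b + 1) - 1) ^ 2
       + (b + 1) * u * (Rpower u (b + 1) + b).
Proof.
  intros ha hab hu.
  assert (hX : 1 <= Rpower u (b + 1)).
  { rewrite <- (Rpower_O u) at 1 by lra. apply Rle_Rpower; lra. }
  set (X := Rpower u (b + 1)) in *.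
  assert (hsq : 0 <= (X + b) ^ 2) by apply pow2_ge_0.
  destruct (Rle_lt_dec b 1) as [hb | hb].
  - apply Rle_trans with (b * (X + b) ^ 2).
    { now apply Rmult_le_compat_r. }
    assert (hXu : X <= u * (1 + b * (u - 1))).
    { unfold X. rewrite Rpower_plus, Rpower_1 by lra.
      rewrite Rmult_comm. apply Rmult_le_compat_l; [lra | ].
      apply Rpower_bernoulli_le; lra. }
    (* For [a = b] the right side minus the left is [b + 1] times this expression, which is affine
       in [X]. *)
    enough (0 <= (u - 2 * b) * X + b * (1 + u - b)) by nra.
    destruct (Rle_lt_dec (2 * b) u) as [h2 | h2].
    { assert (0 <= (u - 2 * b) * X) by (apply Rmult_le_pos; lra). nra. }
    (* The coefficient of [X] is now negative, so the upper bound [hXu] applies. Expanded in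
       [s = u - 1], the result has nonnegative coefficients because [0 < b <= 1]. *)
    apply Rle_trans
      with (b * (1 + u - b) - (2 * b - u) * (u * (1 + b * (u - 1)))).
    2: { assert ((2 * b - u) * X <= (2 * b - u) * (u * (1 + b * (u - 1))))
           by (apply Rmult_le_compat_l; lra). lra. }
    replace u with (1 + (u - 1)) by ring.
    set (s := u - 1). assert (hs : 0 <= s) by (unfold s; lra).
    replace (b * (1 + (1 + s) - b)
             - (2 * b - (1 + s)) * ((1 + s) * (1 + b * (1 + s - 1))))
      with ((1 - b ^ 2) + 2 * (1 - b ^ 2) * s + (1 + 2 * b * (1 - b)) * s ^ 2
            + b * s ^ 3) by ring.
    assert (0 <= s ^ 2) by apply pow2_ge_0.
    assert (0 <= s ^ 3) by now apply pow_le.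
    assert (0 <= 1 - b ^ 2) by nra.
    assert (0 <= 1 + 2 * b * (1 - b)) by nra.
    assert (0 <= (1 - b ^ 2) * s) by now apply Rmult_le_pos.
    assert (0 <= (1 + 2 * b * (1 - b)) * s ^ 2) by now apply Rmult_le_pos.
    assert (0 <= b * s ^ 3) by (apply Rmult_le_pos; lra).
    lra.
  - apply Rle_trans with (1 * (X + b) ^ 2).
    { apply Rmult_le_compat_r; lra. }
    (* Bounding [ln X = (b + 1) * ln u] below by the Padé approximant and above by
       [(b + 1) * (u - 1)] eliminates [u] in favour of [X]. *)
    assert (hpu : b + 1 + 2 * (X - 1) / (X + 1) <= (b + 1) * u).
    { pose proof (ln_ge_pade X hX) as h1.
      unfold X in h1 at 3. unfold Rpower in h1. rewrite ln_exp in h1.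
      pose proof (ln_le_sub_1 u ltac:(lra)) as h2. nra. }
    apply Rle_trans with
      (b * (X - 1) ^ 2 + (b + 1 + 2 * (X - 1) / (X + 1)) * (X + b)).
    2: { apply Rplus_le_compat_l, Rmult_le_compat_r; lra. }
    enough (0 <= b * (X - 1) ^ 2 + (b + 1 + 2 * (X - 1) / (X + 1)) * (X + b)
                 - 1 * (X + b) ^ 2) by lra.
    replace (b * (X - 1) ^ 2 + (b + 1 + 2 * (X - 1) / (X + 1)) * (X + b)
             - 1 * (X + b) ^ 2)
      with ((b - 1) * (X - 1) ^ 2 * X / (X + 1)) by (field; lra).
    apply Rdiv_le_0_compat; [ | lra].
    apply Rmult_le_pos; [apply Rmult_le_pos; [lra | apply pow2_ge_0] | lra].
Qed.

(** * Derivatives of [eta] and of powers of [u] *)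

Lemma Rpower_gt_1 (u p : R) : 1 < u -> 0 < p -> 1 < Rpower u p.
Proof.
  intros hu hp. rewrite <- (Rpower_O u) by lra. now apply Rpower_lt.
Qed.

Lemma is_derive_eta (T alpha lambda mu t : R) :
  1 < alpha -> 0 < lambda -> 0 < mu -> 0 < T -> t < T ->
  is_derive (eta T alpha lambda mu) t
    (1 / (Rpower (1 + lambda * (T - t)) (mu / (lambda * (alpha - 1)) + 1) - 1)).
Proof.
  intros halpha hlambda hmu hT ht.
  set (p := mu / (lambda * (alpha - 1)) + 1).
  assert (hp : 0 < p).
  { assert (0 < mu / (lambda * (alpha - 1)))
      by (apply Rdiv_lt_0_compat; [lra | apply Rmult_lt_0_compat; lra]).
    unfold p; lra. }
  assert (hcont : forall s, s < T ->
    continuous (fun s => 1 / (Rpower (1 + lambda * (T - s)) p - 1)) s).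
  { intros s hs. apply (ex_derive_continuous (V := R_NormedModule)).
    assert (hu : 1 < 1 + lambda * (T - s)) by nra.
    pose proof (Rpower_gt_1 _ p hu hp) as hX. unfold Rpower in *.
    auto_derive. unfold Rminus in *. lra. }
  unfold eta. fold p.
  apply (is_derive_RInt (fun s => 1 / (Rpower (1 + lambda * (T - s)) p - 1))
           _ 0 t); [ | now apply hcont].
  (* This radius keeps [y], hence the whole interval between 0 and [y], below the singularity of the
     integrand at [T]. *)
  exists (mkposreal (T - t) ltac:(lra)). intros y hy.
  apply (RInt_correct (V := R_CompleteNormedModule)), ex_RInt_continuous.
  intros z hz. apply hcont.
  assert (y < T).
  { change (Rabs (y - t) < T - t) in hy. apply Rabs_def2 in hy. lra. }
  assert (Rmax 0 y < T) by (apply Rmax_lub_lt; lra). lra.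
Qed.

Lemma is_derive_Rpower_affine (T lambda p t : R) :
  0 < 1 + lambda * (T - t) ->
  is_derive (fun s => Rpower (1 + lambda * (T - s)) p) t
    (- lambda * p * Rpower (1 + lambda * (T - t)) p / (1 + lambda * (T - t))).
Proof.
  intros hu. unfold Rpower. auto_derive.
  - unfold Rminus in hu. lra.
  - unfold Rminus. field. unfold Rminus in hu. lra.
Qed.

(** * Logarithmic derivative of [F] *)

(** The logarithm of [F = f_T^(-1/alpha)], expanded into a sum so that it can be differentiated term
    by term. *)
Definition log_F (T alpha lambda mu t : R) : R :=
  (alpha - 1) / alpha
    * (ln (Rpower (1 + lambda * (T - t)) (mu / (lambda * (alpha - 1)) + 1) - 1)
       - ln ((mu + lambda * (alpha - 1)) / (alpha - 1)))
  - mu / (lambda * alpha) * ln (1 + lambda * (T - t))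
  + (mu / (alpha - 1) + lambda) * eta T alpha lambda mu t.

Section CriticalPoints.

Variables (T alpha lambda mu : R).
Hypotheses (hT : 0 < T) (halpha : 1 < alpha) (hlambda : 0 < lambda)
  (hmu : 0 < mu).

Let a := (alpha - 1) / alpha.
Let b := mu / (lambda * (alpha - 1)).
Let u t := 1 + lambda * (T - t).
Let X t := Rpower (u t) (b + 1).
Let E t := (mu / (alpha - 1) + lambda) * eta T alpha lambda mu t.

Lemma a_bounds : 0 < a < 1.
Proof using halpha.
  unfold a. split.
  - apply Rdiv_lt_0_compat; lra.
  - apply Rmult_lt_reg_r with alpha; [lra | ]. field_simplify; lra.
Qed.

Lemma b_pos : 0 < b.
Proof using halpha hlambda hmu.
  apply Rdiv_lt_0_compat; [lra | apply Rmult_lt_0_compat; lra].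
Qed.

Lemma u_gt_1 t : t < T -> 1 < u t.
Proof using hlambda. intros ht. unfold u. nra. Qed.

Lemma X_gt_1 t : t < T -> 1 < X t.
Proof using halpha hlambda hmu.
  intros ht. pose proof b_pos.
  apply Rpower_gt_1; [now apply u_gt_1 | lra].
Qed.

Lemma Rpower_f_T t :
  t < T -> Rpower (f_T T alpha lambda mu t) (- (1 / alpha))
           = exp (log_F T alpha lambda mu t).
Proof using halpha hlambda hmu.
  intros ht. pose proof (X_gt_1 t ht) as hX. pose proof (u_gt_1 t ht) as hu.
  unfold X, u, b in hX, hu.
  assert (hc : 0 < mu + lambda * (alpha - 1)) by nra.
  unfold f_T, log_F, Rpower at 1. f_equal.
  rewrite 2!ln_mult, ln_exp
    by (try apply Rmult_lt_0_compat; unfold Rpower; apply exp_pos).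
  unfold Rpower at 1 3. rewrite 2!ln_exp.
  rewrite ln_div, ln_mult by (try apply Rmult_lt_0_compat; lra).
  rewrite (ln_div _ (alpha - 1)) by lra.
  field. lra.
Qed.

Lemma is_derive_E t : t < T -> is_derive E t (lambda * (b + 1) / (X t - 1)).
Proof using hT halpha hlambda hmu.
  intros ht. pose proof (X_gt_1 t ht) as hX.
  pose proof (is_derive_eta T alpha lambda mu t halpha hlambda hmu hT ht) as h.
  fold b in h. fold (u t) in h. fold (X t) in h.
  unfold E. auto_derive.
  - now exists (1 / (X t - 1)).
  - erewrite is_derive_unique by exact h.
    replace (mu / (alpha - 1) + lambda) with (lambda * (b + 1))
      by (unfold b; field; lra).
    field. lra.
Qed.

Lemma is_derive_X t :
  t < T -> is_derive X t (- lambda * (b + 1) * X t / u t).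
Proof using hlambda.
  intros ht. apply is_derive_Rpower_affine. fold (u t).
  pose proof (u_gt_1 t ht). lra.
Qed.

(** The numerator collapses through [a (b + 1) X - a b (X - 1) = a (X + b)]. It vanishes at [t0] by
    the equation for [x0], so [t0] is a critical point of [F]. *)
Lemma is_derive_log_F t :
  t < T ->
  is_derive (log_F T alpha lambda mu) t
    (- lambda * (a * (X t + b) - (b + 1) * u t) / (u t * (X t - 1))).
Proof using hT halpha hlambda hmu.
  intros ht. pose proof (X_gt_1 t ht) as hX. pose proof (u_gt_1 t ht) as hu.
  pose proof (is_derive_E t ht) as hE. pose proof (is_derive_X t ht) as hdX.
  set (c := ln ((mu + lambda * (alpha - 1)) / (alpha - 1))).
  apply (is_derive_ext
    (fun t => a * (ln (X t - 1) - c) - a * b * ln (1 + lambda * (T - t)) + E t)).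
  { intros s. unfold log_F, a, b, E, X, u, c.
    replace (mu / (lambda * alpha))
      with ((alpha - 1) / alpha * (mu / (lambda * (alpha - 1))))
      by (field; lra).
    reflexivity. }
  auto_derive.
  - repeat split; try (unfold u in hu; lra).
    + eexists; exact hdX.
    + eexists; exact hE.
  - erewrite (is_derive_unique E) by exact hE.
    erewrite (is_derive_unique X) by exact hdX.
    fold (u t). change (1 + lambda * (T + - t)) with (u t).
    field. lra.
Qed.

(** * Critical points of [g] and monotonicity of the critical value *)

Lemma g_exp t :
  t < T -> g T alpha lambda mu t
           = exp (log_F T alpha lambda mu t) * (1 - exp (- E t)).
Proof using halpha hlambda hmu.
  intros ht. unfold g. rewrite Rpower_f_T by exact ht.
  unfold E. do 3 f_equal. ring.
Qed.

(** Fermat's rule: once the positive factor [F] is divided out, [g' = 0] is a linear equation in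
    [exp (- E t)]. *)
Lemma critical_point (t l r : R) :
  l < t < r -> r < T ->
  (forall s, l < s < r -> g T alpha lambda mu s <= g T alpha lambda mu t) ->
  1 - exp (- E t) = (b + 1) * u t / (a * (X t + b)).
Proof using hT halpha hlambda hmu.
  intros ht hr hmax.
  assert (htT : t < T) by lra.
  pose proof (X_gt_1 t htT) as hX. pose proof (u_gt_1 t htT) as hu.
  pose proof a_bounds as ha. pose proof b_pos as hb.
  pose proof (is_derive_E t htT) as hE.
  pose proof (is_derive_log_F t htT) as hF.
  set (G := fun s => exp (log_F T alpha lambda mu s) * (1 - exp (- E s))).
  assert (hG : is_derive G t
    (exp (log_F T alpha lambda mu t) *
      (- lambda * (a * (X t + b) - (b + 1) * u t) / (u t * (X t - 1))
         * (1 - exp (- E t))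
       + lambda * (b + 1) / (X t - 1) * exp (- E t)))).
  { unfold G. auto_derive.
    - repeat split; eexists; [exact hF | exact hE].
    - erewrite (is_derive_unique E) by exact hE.
      erewrite is_derive_unique by exact hF.
      field. lra. }
  apply is_derive_Reals in hG.
  set (pr := exist _ _ hG : derivable_pt G t).
  assert (hz : derive_pt G t pr = 0).
  { apply (deriv_maximum G l r t pr); try lra.
    intros s hs1 hs2. unfold G. rewrite <- 2!g_exp by lra. apply hmax. lra. }
  simpl in hz. apply Rmult_integral in hz.
  destruct hz as [hz | hz].
  { pose proof (exp_pos (log_F T alpha lambda mu t)). lra. }
  set (e := exp (- E t)) in *.
  (* Multiplying [hz] by [- u (X - 1) / lambda] clears the denominators; the two terms in
     [(b + 1) u e] then cancel. *)
  assert (hlin : a * (X t + b) * (1 - e) = (b + 1) * u t).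
  { apply Rminus_diag_uniq.
    rewrite <- (Rmult_0_l (- (u t * (X t - 1) / lambda))), <- hz. field. lra. }
  apply Rmult_eq_reg_r with (a * (X t + b)).
  2: { apply Rgt_not_eq, Rmult_lt_0_compat; lra. }
  rewrite Rmult_comm, hlin. field. lra.
Qed.

(* By [critical_point], [(b + 1) / a * exp (K t)] is the value of [g] at an
   interior maximum [t]. *)
Let K t := log_F T alpha lambda mu t + ln (u t) - ln (X t + b).

(** The numerator of the derivative of [K] is [lambda] times the gap between the two sides of
    [key_inequality]. *)
Lemma K_nondecreasing (s t : R) : a <= b -> s <= t < T -> K s <= K t.
Proof using hT halpha hlambda hmu.
  intros hab hst. pose proof a_bounds as ha. pose proof b_pos as hb.
  apply is_derive_nonneg_le with (df := fun t =>
    lambda * (b * (X t - 1) ^ 2 + (b + 1) * u t * (X t + b)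
              - a * (X t + b) ^ 2) / (u t * (X t - 1) * (X t + b))).
  - lra.
  - intros x hx. assert (hxT : x < T) by lra.
    pose proof (X_gt_1 x hxT) as hX. pose proof (u_gt_1 x hxT) as hu.
    pose proof (is_derive_log_F x hxT) as hF.
    pose proof (is_derive_X x hxT) as hdX.
    unfold K, u at 1. auto_derive.
    + repeat split; try (unfold u in hu; lra).
      * eexists; exact hF.
      * eexists; exact hdX.
    + erewrite (is_derive_unique X) by exact hdX.
      erewrite is_derive_unique by exact hF.
      change (1 + lambda * (T + - x)) with (u x).
      field. lra.
  - intros x hx. assert (hxT : x < T) by lra.
    pose proof (X_gt_1 x hxT) as hX. pose proof (u_gt_1 x hxT) as hu.
    pose proof (key_inequality a b (u x) ha hab ltac:(lra)) as hk.
    fold (X x) in hk.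
    apply Rdiv_le_0_compat.
    + apply Rmult_le_pos; lra.
    + repeat apply Rmult_lt_0_compat; lra.
Qed.

(** The chain is [g t = (b + 1) / a * exp (K t) <= (b + 1) / a * exp (K r) = F r]. The last equality
    holds because the equation at [r] makes the factor [(b + 1) u / (a (X + b))] equal to 1. *)
Lemma g_le_at_critical_point (t l r : R) :
  a <= b ->
  l < t < r -> r < T ->
  (forall s, l < s < r -> g T alpha lambda mu s <= g T alpha lambda mu t) ->
  a * (X r + b) = (b + 1) * u r ->
  g T alpha lambda mu t <= exp (log_F T alpha lambda mu r).
Proof using hT halpha hlambda hmu.
  intros hab ht hr hmax hcr. assert (htT : t < T) by lra.
  rewrite g_exp, (critical_point t l r) by assumption.
  pose proof (X_gt_1 t htT) as hXt. pose proof (u_gt_1 t htT) as hut.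
  pose proof (X_gt_1 r hr) as hXr. pose proof (u_gt_1 r hr) as hur.
  pose proof a_bounds as ha. pose proof b_pos as hb.
  pose proof (K_nondecreasing t r hab ltac:(lra)) as hK.
  assert (hexp : forall s, 1 < u s -> 1 < X s ->
    exp (K s) = exp (log_F T alpha lambda mu s) * (u s / (X s + b))).
  { intros s hus hXs. unfold K, Rminus.
    rewrite 2!exp_plus, exp_Ropp, 2!exp_ln by lra. field. lra. }
  assert (hKe : exp (K t) <= exp (K r))
    by (apply Rnot_lt_le; intros h%exp_lt_inv; lra).
  rewrite 2!hexp in hKe by assumption.
  replace (exp (log_F T alpha lambda mu t) * ((b + 1) * u t / (a * (X t + b))))
    with ((b + 1) / a * (exp (log_F T alpha lambda mu t) * (u t / (X t + b))))
    by (field; lra).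
  replace (exp (log_F T alpha lambda mu r))
    with ((b + 1) / a * (exp (log_F T alpha lambda mu r) * (u r / (X r + b)))).
  - apply Rmult_le_compat_l; [ | exact hKe].
    apply Rlt_le, Rdiv_lt_0_compat; lra.
  - replace (X r + b) with ((b + 1) * u r / a) by (rewrite <- hcr; field; lra).
    field. lra.
Qed.

(** * The threshold on [alpha] and the equation at [t0] *)

Lemma a_le_b :
  alpha <= 1 + (mu + sqrt (4 * lambda * mu + mu ^ 2)) / (2 * lambda) -> a <= b.
Proof using halpha hlambda hmu.
  intros h. set (q := sqrt (4 * lambda * mu + mu ^ 2)) in *.
  assert (hq : q * q = 4 * lambda * mu + mu ^ 2) by (apply sqrt_sqrt; nra).
  assert (hq0 : 0 <= q) by apply sqrt_pos.
  assert (h1 : 2 * lambda * (alpha - 1) - mu <= q).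
  { apply (Rmult_le_compat_l (2 * lambda)) in h; [ | lra].
    field_simplify in h; lra. }
  assert (h2 : lambda * (alpha - 1) ^ 2 <= mu * alpha).
  (* If the left side of [h1] is positive, squaring gives the claim; otherwise
     [lambda * (alpha - 1) <= mu / 2] already suffices. *)
  { destruct (Rle_lt_dec (2 * lambda * (alpha - 1) - mu) 0); nra. }
  unfold a, b.
  apply Rmult_le_reg_r with (alpha * (lambda * (alpha - 1))).
  { repeat apply Rmult_lt_0_compat; lra. }
  field_simplify; lra.
Qed.

Lemma u_t0 (x : R) : u (t0 T alpha lambda x) = Rpower x (alpha - 1).
Proof using hlambda. unfold u, t0. field. lra. Qed.

(** At [t0], [u = x^(alpha - 1)] and [X = x^(mu/lambda + alpha - 1)]. Since
    [mu / lambda = b (alpha - 1)], this is the equation for [x0] divided by [alpha]. *)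
Lemma t0_equation (x : R) :
  is_x0 alpha lambda mu x ->
  a * (X (t0 T alpha lambda x) + b) = (b + 1) * u (t0 T alpha lambda x).
Proof using halpha hlambda.
  intros [hx heq]. unfold X. rewrite u_t0, Rpower_mult.
  replace ((alpha - 1) * (b + 1)) with (mu / lambda + alpha - 1)
    by (unfold b; field; lra).
  fold b in heq.
  replace (mu / lambda) with (b * (alpha - 1)) in heq at 2
    by (unfold b; field; lra).
  apply Rmult_eq_reg_l with alpha; [ | lra].
  unfold a. field_simplify; [ | lra]. lra.
Qed.

Lemma t0_lt_T (x : R) : 1 < x -> t0 T alpha lambda x < T.
Proof using halpha hlambda.
  intros hx. pose proof (Rpower_gt_1 x (alpha - 1) hx ltac:(lra)).
  assert (0 < (Rpower x (alpha - 1) - 1) / lambda)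
    by (apply Rdiv_lt_0_compat; lra).
  unfold t0. lra.
Qed.

End CriticalPoints.

(** * Comparison at an interior maximum and at the two endpoints *)

Theorem theorem10 (T alpha lambda mu x0 tau_star : R)
  (hT : 0 < T) (halpha : 1 < alpha) (hlambda : 0 < lambda) (hmu : 0 < mu)
  (hx0 : is_x0 alpha lambda mu x0)
  (ht0 : 0 < t0 T alpha lambda x0)
  (htau : is_argmax (g T alpha lambda mu) 0 (t0 T alpha lambda x0) tau_star)
  (hbound : 1 < alpha <=
     1 + (mu + sqrt (4 * lambda * mu + mu ^ 2)) / (2 * lambda)) :
  Rpower (f_T T alpha lambda mu (t0 T alpha lambda x0)) (- (1 / alpha))
    >= g T alpha lambda mu tau_star.
Proof.
  assert (hr : t0 T alpha lambda x0 < T)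
    by (apply t0_lt_T; try assumption; apply hx0).
  rewrite Rpower_f_T by assumption. apply Rle_ge.
  destruct htau as [[hl hu] hmax].
  set (r := t0 T alpha lambda x0) in *.
  pose proof (exp_pos (log_F T alpha lambda mu r)) as hpos.
  (* The cases are an interior maximum, [tau_star = r] where [1 - exp (- E) < 1], and [tau_star = 0]
     where [eta] and hence [g] vanish. *)
  destruct hl as [hl | <-]; [destruct hu as [hu | ->] | ].
  - apply g_le_at_critical_point with (l := 0); try assumption.
    + apply a_le_b; try assumption. apply hbound.
    + lra.
    + intros s hs. apply hmax. lra.
    + now apply t0_equation.
  - rewrite g_exp by assumption.
    set (e := exp (- _)). assert (0 < e) by apply exp_pos. nra.
  - rewrite g_exp by assumption. unfold eta.
    rewrite RInt_point. change (zero : R) with 0.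
    rewrite Rmult_0_r, Ropp_0, exp_0. lra.
Qed.
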